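(* Let $n\ge 6$ be a fixed integer. Then $N_{LP}(n,k)=\Theta(k^{n-1})$ as $k\to\infty$; that is, there are constants $0<c_n\le C_n$ depending only on $n$ such that $c_n k^{n-1}\le N_{LP}(n,k)\le C_n k^{n-1}$ for all sufficiently large integers $k$.
   Context: For an integer $n\ge 3$ let $w(t)=(1-t^2)^{\frac{n-3}{2}}$ on $(-1,1)$, and let $P_s=P_s^{\frac{n-3}{2},\frac{n-3}{2}}$ ($s=0,1,2,\dots$) be the Jacobi polynomials of degree $s$, orthogonal on $(-1,1)$ with respect to the weight $w$, with the standard (Szegő) normalization $P_s(1)=\binom{s+\frac{n-3}{2}}{s}$, so $P_0\equiv 1$. The linear programming bound for spherical designs in dimension $n$ with strength $k$ is $$N_{LP}(n,k)=\sup\Big\{\frac1{a_0}:\ F=\sum_{s=0}^m a_sP_s,\ F\ge 0\text{ on }[-1,1],\ F(1)=1,\ a_s\le 0\text{ for all } s\ge k\Big\},$$ where the $a_s$ are real and the degree $m$ may be arbitrarily large. *)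

(* Defs.v *)
From HB Require Import structures.
From mathcomp Require Import all_boot all_order all_algebra.
From mathcomp Require Import all_classical all_reals all_analysis.
From mathcomp Require Import measurable_realfun.
From mathcomp Require Import ring lra.

Set Implicit Arguments.
Unset Strict Implicit.
Unset Printing Implicit Defensive.

Import Order.TTheory GRing.Theory Num.Theory.
Import numFieldNormedType.Exports.

Local Open Scope classical_set_scope.
Local Open Scope ring_scope.

(* Generalized binomial coefficient x (x - 1) ... (x - s + 1) / s!. *)
Definition gbinom (R : realType) (x : R) (s : nat) : R :=
  (\prod_(i < s) (x - i%:R)) / s`!%:R.

Definition jacobi_exponent (R : realType) (n : nat) : R := (n%:R - 3%:R) / 2%:R.

Definition jacobi_weight (R : realType) (n : nat) (t : R) : R :=
  (1 - t ^+ 2) `^ jacobi_exponent R n.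

Definition jacobi_ip (R : realType) (n : nat) (p q : {poly R}) : R :=
  \int[@lebesgue_measure R]_(t in `]-1, 1[)
    (p.[t] * q.[t] * jacobi_weight n t).

Definition is_jacobi_family (R : realType) (n : nat) (P : nat -> {poly R}) :=
  [/\ forall s, size (P s) = s.+1,
      forall r s, r != s -> jacobi_ip n (P r) (P s) = 0
    & forall s, (P s).[1] = gbinom (s%:R + jacobi_exponent R n) s].

(* For n >= 3 exactly one family satisfies is_jacobi_family (jacobiP and
   jacobi_unique below), so the default value 0 is never used. *)
Definition jacobi (R : realType) (n : nat) : nat -> {poly R} :=
  xget (fun=> 0) [set P | is_jacobi_family n P].

(* For n >= 3 these constraints force a_0 > 0, since a_0 \int w = \int F w and
   F is a nonzero polynomial that is nonnegative on [-1, 1]. *)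
Definition lp_feasible (R : realType) (n k m : nat) (a : nat -> R) : Prop :=
  let F : {poly R} := \sum_(s < m.+1) a s *: jacobi R n s in
  [/\ forall t : R, -1 <= t <= 1 -> 0 <= F.[t],
      F.[1] = 1
    & forall s : nat, (k <= s <= m)%N -> a s <= 0].

(* The supremum is taken in the extended reals, so that it exists without
   knowing beforehand that the set is nonempty and bounded. *)
Definition NLP (R : realType) (n k : nat) : \bar R :=
  ereal_sup [set x : \bar R |
    exists m a, lp_feasible n k m a /\ x = (1 / a 0%N : R)%:E].

Section jacobi_existence.
Variables (R : realType) (n : nat).
Hypothesis n_ge3 : (3 <= n)%N.

Local Notation mu := (@lebesgue_measure R).
Local Notation w := (@jacobi_weight R n).
Local Notation ip := (@jacobi_ip R n).
Local Notation I := (`]-1, 1[%classic : set R).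

Local Lemma jacobi_exponent_ge0 : 0 <= jacobi_exponent R n.
Proof. by rewrite divr_ge0 ?ler0n// subr_ge0 ler_nat. Qed.

Local Lemma jacobi_weight_gt0 t : I t -> 0 < w t.
Proof.
rewrite /= in_itv/= => /andP[t1 t2]; rewrite powR_gt0//.
by rewrite (_ : 1 - t ^+ 2 = (1 - t) * (1 + t)); [rewrite mulr_gt0//; lra|ring].
Qed.

Local Lemma jacobi_weight_le1 t : I t -> w t <= 1.
Proof.
rewrite /= in_itv/= => /andP[t1 t2].
have t0 : 0 <= 1 - t ^+ 2.
  by rewrite (_ : _ - _ = (1 - t) * (1 + t)); [rewrite mulr_ge0//; lra|ring].
rewrite [leRHS](_ : 1 = 1 `^ jacobi_exponent R n); last by rewrite powR1.
apply: (ge0_ler_powR jacobi_exponent_ge0); rewrite ?nnegrE ?ler01//.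
by rewrite gerBl sqr_ge0.
Qed.

Local Lemma mu_itv : mu I = 2%:E.
Proof. by rewrite lebesgue_measure_itv/= lte_fin ifT -?EFinD; [congr EFin; ring|lra]. Qed.

Local Lemma measurable_polyw (p : {poly R}) :
  measurable_fun I (fun t => p.[t] * w t).
Proof.
apply: measurable_funM.
  by apply: measurable_funTS; apply: continuous_measurable_fun;
     exact: continuous_horner.
apply: (measurableT_comp (measurable_powR _)).
apply: measurable_funB => //.
Qed.

Local Lemma integrable_polyw (p : {poly R}) :
  mu.-integrable I (EFin \o (fun t => p.[t] * w t)).
Proof.
apply: measurable_bounded_integrable => //.
- by rewrite [X in (X < _)%E]mu_itv ltry.
- exact: measurable_polyw.
- pose M := \sum_(i < size p) `|p`_i|; exists M; split; first exact: num_real.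
  move=> x Mx t tI /=; rewrite (le_trans _ (ltW Mx))// normrM.
  rewrite [`|w t|]gtr0_norm ?jacobi_weight_gt0//.
  rewrite -[leRHS]mulr1 ler_pM ?normr_ge0 ?(ltW (jacobi_weight_gt0 _))//.
    rewrite horner_coef (le_trans (ler_norm_sum _ _ _))// ler_sum// => i _.
    rewrite normrM ler_piMr// normrX exprn_ile1//.
    by move: tI; rewrite /= in_itv/= => /andP[? ?]; rewrite ler_norml; lra.
  exact: jacobi_weight_le1.
Qed.

Local Lemma jacobi_ipE p q : ip p q = \int[mu]_(t in I) ((p * q).[t] * w t).
Proof. by apply: eq_Rintegral => t _; rewrite hornerM. Qed.

Local Lemma jacobi_ipC p q : ip p q = ip q p.
Proof. by rewrite !jacobi_ipE mulrC. Qed.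

Local Lemma jacobi_ipDl p q r : ip (p + q) r = ip p r + ip q r.
Proof.
rewrite !jacobi_ipE -RintegralD//; try exact: integrable_polyw.
by apply: eq_Rintegral => t _; rewrite mulrDl hornerD mulrDl.
Qed.

Local Lemma jacobi_ipZl a p q : ip (a *: p) q = a * ip p q.
Proof.
rewrite !jacobi_ipE -RintegralZl//; last exact: integrable_polyw.
by apply: eq_Rintegral => t _; rewrite -scalerAl hornerZ mulrA.
Qed.

Local Lemma jacobi_ipBl p q r : ip (p - q) r = ip p r - ip q r.
Proof. by rewrite -scaleN1r jacobi_ipDl jacobi_ipZl mulN1r. Qed.

Local Lemma jacobi_ipDr p q r : ip r (p + q) = ip r p + ip r q.
Proof. by rewrite jacobi_ipC jacobi_ipDl !(jacobi_ipC r). Qed.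

Local Lemma jacobi_ipZr a p q : ip q (a *: p) = a * ip q p.
Proof. by rewrite jacobi_ipC jacobi_ipZl jacobi_ipC. Qed.

Local Lemma jacobi_ip0r p : ip p 0 = 0.
Proof. by rewrite -(scale0r 0) jacobi_ipZr mul0r. Qed.

Local Lemma Rintegral_polyw_eq0 (p : {poly R}) :
    (forall t, I t -> 0 <= p.[t]) -> \int[mu]_(t in I) (p.[t] * w t) = 0 ->
  p = 0.
Proof.
move=> p0 ip0; apply/eqP/negP => /negP p_neq0.
have mI : measurable I by exact: measurable_itv.
have := integrable_polyw p => /integrableP[mf _].
have abs0 : (\int[mu]_(t in I) `|(p.[t] * w t)%:E| = 0)%E.
  transitivity (\int[mu]_(t in I) (p.[t] * w t)%:E)%E.
    apply: eq_integral => t /[!inE] It; rewrite gee0_abs// lee_fin mulr_ge0 ?p0//.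
    exact/ltW/jacobi_weight_gt0.
  by rewrite -[LHS]fineK; [rewrite -/(Rintegral _ _ _) ip0|
    exact: integrable_fin_num (integrable_polyw p)].
have /(ae_eq_integral_abs mu mI mf)[N [mN N0 sub]] := abs0.
have croot : countable [set t | root p t].
  apply: finite_set_countable.
  apply: contrapT => inf.
  have [A Aroot] := infinite_set_fset (size p) inf.
  apply/negP; rewrite -ltnNge; apply: max_poly_roots => //; last first.
    exact: finmap.fset_uniq.
  by apply/allP => t /Aroot.
have /negligibleP-/(_ mI) : mu.-negligible I.
  apply: (@negligibleS _ _ _ _ (N `|` [set t | root p t])).
    move=> t It; have [rt|nrt] := boolP (root p t); [by right|left].
    apply: sub => /= /(_ It) [] /eqP; rewrite mulf_eq0.
    by rewrite -[_ == 0]/(root p t) (negbTE nrt)/= gt_eqF// jacobi_weight_gt0.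
  apply: negligibleU; first by exists N; split.
  exists [set t | root p t]; split => //.
    by apply: countable_measurable croot => t; exact: measurable_set1.
  exact: countable_lebesgue_measure0.
by rewrite [LHS]mu_itv => -[] /eqP; rewrite pnatr_eq0.
Qed.

Local Lemma jacobi_ip_eq0 p : ip p p = 0 -> p = 0.
Proof.
rewrite jacobi_ipE => /Rintegral_polyw_eq0 pp0.
apply/eqP; rewrite -[_ == _]orbb -mulf_eq0 pp0// => t _.
by rewrite hornerM -expr2 sqr_ge0.
Qed.

Local Definition lower_orthogonal (s : nat) (p : {poly R}) :=
  forall u : {poly R}, (size u <= s)%N -> ip p u = 0.

Local Lemma size_polyB_lead (p : {poly R}) (e : {poly R}) s :
  (size p <= s.+1)%N -> size e = s.+1 ->
  (size (p - (p`_s / e`_s) *: e)%R <= s)%N.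
Proof.
move=> ps es; have es0 : e`_s != 0.
  by have := lead_coef_eq0 e; rewrite lead_coefE es => ->;
     rewrite -size_poly_eq0 es.
apply/leq_sizeP => j; rewrite leq_eqVlt => /predU1P[<-|sj].
  by rewrite coefB coefZ divfK// subrr.
by rewrite coefB coefZ [e`_j]nth_default ?es// mulr0 subr0
  nth_default// (leq_trans ps).
Qed.

Local Lemma lower_orthogonal_proj s (r : {poly R}) :
  exists q : {poly R}, (size q <= s)%N /\ lower_orthogonal s (r - q).
Proof.
elim: s r => [|s IH] r.
  exists 0; split; rewrite ?size_poly0// => u.
  by rewrite leqn0 size_poly_eq0 => /eqP ->; rewrite jacobi_ip0r.
have [qX [sqX oqX]] := IH 'X^s; pose e := 'X^s - qX.
have se : size e = s.+1 by rewrite size_polyDl ?size_polyXn// size_polyN.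
have ee0 : ip e e != 0.
  apply: contraPneq se => /jacobi_ip_eq0 ->; rewrite size_poly0.
  by move=> /eqP.
have [q [sq oq]] := IH r; pose c := ip (r - q) e / ip e e.
exists (q + c *: e); split.
  rewrite (leq_trans (size_polyD _ _))// geq_max (leq_trans sq)//=.
  by rewrite (leq_trans (size_scale_leq _ _))// se.
move=> u su; rewrite -[u](subrK ((u`_s / e`_s) *: e)) jacobi_ipDr.
have su' := size_polyB_lead su se.
rewrite opprD addrA (jacobi_ipBl (r - q)) jacobi_ipZl (oq _ su') (oqX _ su').
rewrite mulr0 subr0 add0r jacobi_ipZr (jacobi_ipBl (r - q)) jacobi_ipZl.
by rewrite /c divfK// subrr mulr0.
Qed.

Local Lemma lower_orthogonal_neq0 s (p : {poly R}) :
  size p = s.+1 -> lower_orthogonal s p -> p.[1] != 0.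
Proof.
move=> sp op; apply/negP => /factor_theorem[q qp].
have q0 : q != 0.
  by apply/eqP => q0; move/eqP: sp; rewrite qp q0 mul0r size_poly0.
have sq : (size q <= s)%N.
  by move: sp; rewrite qp size_Mmonic ?monicXsubC// size_XsubC addn2/= => -[->].
have ip0 : \int[mu]_(t in I) ((- p * q).[t] * w t) = 0.
  by rewrite -jacobi_ipE -scaleN1r jacobi_ipZl op// mulr0.
have pq0 : - p * q = 0.
  apply: Rintegral_polyw_eq0 ip0 => t; rewrite /= in_itv/= => /andP[t1 t2].
  rewrite qp (_ : _ * q = q ^+ 2 * (1 - 'X)); last by rewrite polyC1; ring.
  rewrite hornerM horner_exp hornerD hornerN hornerC hornerX.
  by rewrite mulr_ge0 ?sqr_ge0// subr_ge0 ltW.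
move/eqP: pq0; rewrite mulf_eq0 oppr_eq0 (negbTE q0) orbF.
by rewrite -size_poly_eq0 sp.
Qed.

Local Lemma gbinom_jacobi_gt0 s : 0 < gbinom (s%:R + jacobi_exponent R n) s.
Proof.
rewrite divr_gt0 ?ltr0n ?fact_gt0//; apply: prodr_gt0 => i _.
rewrite addrAC ltr_wpDr ?jacobi_exponent_ge0//.
by rewrite subr_gt0 ltr_nat.
Qed.

Lemma is_jacobi_family_exists : exists P, @is_jacobi_family R n P.
Proof.
have H s : exists p : {poly R}, [/\ size p = s.+1, lower_orthogonal s p
    & p.[1] = gbinom (s%:R + jacobi_exponent R n) s].
  have [q [sq oq]] := lower_orthogonal_proj s 'X^s.
  have se : size ('X^s - q) = s.+1 by rewrite size_polyDl ?size_polyXn// size_polyN.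
  have e1 := lower_orthogonal_neq0 se oq.
  exists ((gbinom (s%:R + jacobi_exponent R n) s / ('X^s - q).[1]) *: ('X^s - q)).
  split.
  - by rewrite size_scale// mulf_neq0 ?invr_eq0// gt_eqF// gbinom_jacobi_gt0.
  - by move=> u su; rewrite jacobi_ipZl oq// mulr0.
  - by rewrite hornerZ divfK.
have [P HP] := choice H; exists P; split=> [s|r s rs|s].
- by have [] := HP s.
- have [sr oR _] := HP r; have [ss oS _] := HP s.
  move: rs; rewrite neq_ltn => /orP[rs|sr'].
    by rewrite jacobi_ipC oS// sr.
  by rewrite oR// ss.
- by have [] := HP s.
Qed.

Lemma jacobiP : is_jacobi_family n (@jacobi R n).
Proof. exact: (xgetPex _ is_jacobi_family_exists). Qed.

Local Lemma jacobi_family_lower P s :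
  is_jacobi_family n P -> lower_orthogonal s (P s).
Proof.
move=> [sP oP _].
suff H j : (j <= s)%N -> lower_orthogonal j (P s) by exact: H.
elim: j => [_ u|j IH js u su].
  by rewrite leqn0 size_poly_eq0 => /eqP ->; rewrite jacobi_ip0r.
rewrite -[u](subrK ((u`_j / (P j)`_j) *: P j)).
rewrite jacobi_ipDr jacobi_ipZr oP ?gt_eqF// mulr0 addr0.
by rewrite (IH (ltnW js))// size_polyB_lead.
Qed.

Lemma jacobi_unique P : is_jacobi_family n P -> P = @jacobi R n.
Proof.
move=> HP; apply/funext => s.
have HJ := jacobiP; have [sP _ P1] := HP; have [sJ _ J1] := HJ.
pose c := (P s)`_s / (jacobi R n s)`_s.
pose D := P s - c *: jacobi R n s.
have sD : (size D <= s)%N by rewrite size_polyB_lead// sP.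
have : D = 0.
  apply: jacobi_ip_eq0; rewrite {1}/D jacobi_ipBl jacobi_ipZl.
  by rewrite !(jacobi_family_lower _ sD)// mulr0 subrr.
move=> /subr0_eq PJ.
have : (P s).[1] = c * (jacobi R n s).[1] by rewrite PJ hornerZ.
rewrite P1 J1 -[X in X = _]mul1r => /mulIf.
by rewrite gt_eqF ?gbinom_jacobi_gt0// => /(_ isT) c1; rewrite PJ -c1 scale1r.
Qed.

End jacobi_existence.

(* Main.v *)
(* Let K_d = sum_(s <= d) P_s(1) P_s / h_s, where h_s is the squared norm of P_s,
   be the reproducing kernel at 1 of the polynomials of degree at most d.  If F
   is feasible, then 1 = F(1) <= sum_(s < k) a_s P_s(1) = <F, K_(k-1)>, and since
   P_s <= P_s(1) on [-1, 1], this is at most K_(k-1)(1) <F, 1>, a multiple of a_0.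
   Conversely (K_d / K_d(1))^2 with 2 d < k is feasible and <(K_d)^2, 1> = K_d(1).
   So NLP lies between <1, 1> K_d(1) with d = (k - 1) / 2 and <1, 1> K_(k-1)(1).
   These numbers are found from the norms and the values at 1 of the P_s:
   integration by parts gives the Gegenbauer differential equation, which
   determines the two top coefficients of P_s after the leading one and hence
   the three-term recurrence. *)

Require Import Defs.
From mathcomp Require Import all_boot all_order all_algebra.
From mathcomp Require Import all_classical all_reals all_analysis.
From mathcomp Require Import measurable_realfun.
From mathcomp Require Import ring lra zify.
Import Order.TTheory GRing.Theory Num.Theory.
Import numFieldNormedType.Exports.

Local Open Scope classical_set_scope.
Local Open Scope ring_scope.

(** * The weight and integration by parts *)

Section Weight.
Variables (R : realType) (n : nat).
Hypothesis n_ge3 : (3 <= n)%N.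

Local Notation ip := (@jacobi_ip R n).
Local Notation mu := (@lebesgue_measure R).

(** The exponent (n - 3) / 2 may be a half-integer. Written with this square root, the weight
    becomes a natural power, to which the rules for derivatives of powers apply. *)
Let v (t : R) := Num.sqrt (1 - 'X ^+ 2 : {poly R}).[t].

Let vE (t : R) : (1 - 'X ^+ 2 : {poly R}).[t] = 1 - t ^+ 2.
Proof. by rewrite !hornerE. Qed.

Let v2 (t : R) : -1 <= t <= 1 -> v t ^+ 2 = 1 - t ^+ 2.
Proof. by move=> t1; rewrite sqr_sqrtr vE//; nra. Qed.

Let jacobi_weightE (t : R) : -1 <= t <= 1 ->
  jacobi_weight n t = v t ^+ (n - 3).
Proof.
move=> t1; have t0 : 0 <= 1 - t ^+ 2 by nra.
rewrite /jacobi_weight /jacobi_exponent -natrB// mulrC powRrM.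
by rewrite powR12_sqrt// powR_mulrn ?sqrtr_ge0// /v vE.
Qed.

Let continuous_v : continuous v.
Proof.
move=> x; apply: continuous_comp; first exact: continuous_horner.
exact: sqrt_continuous.
Qed.

Let is_derive_v (t : R) : -1 < t < 1 -> is_derive t 1 v (- t / v t).
Proof.
move=> t1.
have t0 : 0 < (1 - 'X ^+ 2 : {poly R}).[t] by rewrite vE; nra.
have ? := is_derive1_sqrt t0.
have ? := is_derive_poly (1 - 'X ^+ 2 : {poly R}) t.
have v0 : v t != 0 by rewrite gt_eqF// sqrtr_gt0.
have dc := @is_derive1_comp _ Num.sqrt (horner (1 - 'X ^+ 2 : {poly R})) t _ _ _ _.
apply: (is_derive_eq (dc _ _ _ _)).
rewrite -/(v t) derivB derivXn /= -polyC1 derivC !hornerE.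
by field.
Qed.

(* Integrating the derivative of (1 - t^2)^((n - 1) / 2) f(t) over [-1, 1]. *)
Lemma jacobi_ip_ibp (f : {poly R}) :
  ip ((1 - 'X ^+ 2) * f^`() - (n - 1)%:R *: ('X * f)) 1 = 0.
Proof.
rewrite Defs.jacobi_ipE mulr1; set p := _ - _.
pose G (t : R) := v t ^+ (n - 1) * f.[t].
(* The end points are added because the fundamental theorem of calculus is applied on the closed
   interval. *)
rewrite /Rintegral -(@integral_itv_bndoo _ _ _ _ true false); last first.
  by apply/measurable_EFinP; exact: Defs.measurable_polyw.
pose J : set R := `[-1, 1]%classic.
rewrite -/J; have -> : (\int[mu]_(t in J) (p.[t] * jacobi_weight n t)%:E =
    \int[mu]_(t in J) (v t ^+ (n - 3) * p.[t])%:E)%E.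
  apply: eq_integral => t /[!inE]; rewrite /J /= in_itv/= => t1.
  by rewrite jacobi_weightE// mulrC.
have cX k : continuous (fun t => v t ^+ k).
  move=> t; apply: (@continuous_comp _ _ _ v (fun x => x ^+ k)).
    exact: continuous_v.
  exact: exprn_continuous.
have dG (t : R) : -1 < t < 1 -> is_derive t (1 : R) G (v t ^+ (n - 3) * p.[t]).
  move=> t1; have dv := is_derive_v _ t1; have df := is_derive_poly f t.
  have -> : G = (v ^+ (n - 1)) * horner f by apply/funext => x; rewrite mulrfctE exprfctE.
  have dM := @is_deriveM _ _ _ _ _ _ _ _ (is_deriveX (n - 1) dv) df.
  apply: (is_derive_eq dM).
  have v0 : v t != 0 by rewrite gt_eqF// sqrtr_gt0 vE; nra.
  have -> : p.[t] = v t ^+ 2 * f^`().[t] - (n - 1)%:R * (t * f.[t]).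
    by rewrite v2; [rewrite /p !hornerE|lra].
  (* The factor [1 / v t] from the derivative of [v] cancels against a power of [v t], leaving
     [v t ^+ (n - 3)] in both terms. *)
  have -> : (n - 1 = (n - 3).+2)%N by lia.
  rewrite !exprfctE /= !exprS; rewrite -![_ *: _]/(_ * _).
  by field.
rewrite (@continuous_FTC2 _ _ G).
(* Both boundary terms vanish, as [v] is 0 at the end points and n - 1 > 0. *)
- rewrite /G /v !vE expr1n sqrrN expr1n subrr sqrtr0.
  by rewrite !expr0n subn_eq0 leqNgt (leq_trans _ n_ge3)//= !mul0r subrr.
- by lra.
- apply: continuous_subspaceT => t.
  by apply: cvgM; [exact: cX|exact: continuous_horner].
- have cG : continuous G.
    by move=> t; apply: cvgM; [exact: cX|exact: continuous_horner].
  split.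
  + by move=> t; rewrite in_itv/= => /dG[].
  + exact/cvg_at_right_filter/cG.
  + exact/cvg_at_left_filter/cG.
- by move=> t; rewrite in_itv/= => t1; have ? := dG t t1; rewrite derive1E derive_val.
Qed.
End Weight.

(** * The differential equation *)

Section Jacobi.
Variables (R : realType) (n : nat).
Hypothesis n_ge3 : (3 <= n)%N.

Local Notation ip := (@jacobi_ip R n).
Local Notation P := (jacobi R n).
Local Notation nu := (n%:R : R).

Let nu_ge3 : 3 <= nu. Proof. by rewrite ler_nat. Qed.

Lemma jacobi_ipMC (p q r : {poly R}) : ip (p * q) r = ip p (q * r).
Proof. by rewrite !Defs.jacobi_ipE mulrA. Qed.

Lemma jacobi_ip_ge0 (p : {poly R}) :
  (forall t : R, -1 <= t <= 1 -> 0 <= p.[t]) -> 0 <= ip p 1.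
Proof.
move=> p0; rewrite Defs.jacobi_ipE mulr1; apply: Rintegral_ge0 => t /= t1.
apply: mulr_ge0; last exact/ltW/Defs.jacobi_weight_gt0.
by apply: p0; move: t1; rewrite in_itv/= => /andP[/ltW-> /ltW->].
Qed.

Lemma jacobi_ip_gt0 (p : {poly R}) : p != 0 -> 0 < ip p p.
Proof.
move=> p0; rewrite lt_neqAle; apply/andP; split.
  by apply: contra_neqN p0 => /eqP/esym/(Defs.jacobi_ip_eq0 n_ge3).
have -> : ip p p = ip (p * p) 1 by rewrite jacobi_ipMC mulr1.
apply: jacobi_ip_ge0 => t _.
by rewrite hornerM -expr2 sqr_ge0.
Qed.

Lemma size_jacobi s : size (P s) = s.+1.
Proof. by have [->] := jacobiP R n_ge3. Qed.

Lemma jacobi_orthogonal r s : r != s -> ip (P r) (P s) = 0.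
Proof. by have [_ + _] := jacobiP R n_ge3; apply. Qed.

Lemma jacobi_neq0 s : P s != 0.
Proof. by rewrite -size_poly_eq0 size_jacobi. Qed.

Lemma jacobi1_gt0 s : 0 < (P s).[1].
Proof. by have [_ _ ->] := jacobiP R n_ge3; exact: Defs.gbinom_jacobi_gt0. Qed.

Lemma jacobi_lower s (u : {poly R}) : (size u <= s)%N -> ip (P s) u = 0.
Proof. exact: (Defs.jacobi_family_lower n_ge3 (jacobiP R n_ge3)). Qed.

(** This is the Laplacian of the unit sphere in R^n acting on functions of one coordinate. *)
Definition gegenbauer_op (p : {poly R}) : {poly R} :=
  (1 - 'X ^+ 2) * p^`()^`() - (n - 1)%:R *: ('X * p^`()).

Local Notation A := gegenbauer_op.

Lemma gegenbauer_op_sym (p q : {poly R}) : ip (A p) q = ip p (A q).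
Proof.
have E (f g : {poly R}) : ip (A f) g = - ip ((1 - 'X ^+ 2) * f^`() * g^`()) 1.
  apply/eqP; rewrite -addr_eq0 -[g in ip _ g]mulr1 -jacobi_ipMC.
  rewrite -Defs.jacobi_ipDl//; apply/eqP; rewrite -(jacobi_ip_ibp _ _ n_ge3 (f^`() * g)).
  congr (ip _ 1); rewrite /A derivM -!mul_polyC.
  by move: (f^`()) (f^`()^`()) (g^`()) (_%:P) => a b c e; ring.
by rewrite E (Defs.jacobi_ipC _ p) E mulrAC.
Qed.

Lemma coef_gegenbauer_op (p : {poly R}) i : (A p)`_i =
  (i.+1%:R * i.+2%:R) * p`_i.+2 - (i%:R * (i%:R + nu - 2)) * p`_i.
Proof.
have n1 : (n - 1)%:R = nu - 1 by rewrite natrB// ltnW// ltnW.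
rewrite /A n1 mulrBl mul1r coefB coefB coefZ.
rewrite coefXM coefXnM.
have c1 j : p^`()`_j = j.+1%:R * p`_j.+1 by rewrite coef_deriv mulr_natl.
have c2 j : p^`()^`()`_j = j.+1%:R * (j.+2%:R * p`_j.+2).
  by rewrite coef_deriv c1 [RHS]mulr_natl.
rewrite c2; case: i => [|[|i]] /=.
- ring.
- rewrite c1. ring.
- rewrite subn2 /= c1 c2. ring.
Qed.

Lemma size_gegenbauer_op (p : {poly R}) : (size (A p) <= size p)%N.
Proof.
apply/leq_sizeP => j sj; rewrite coef_gegenbauer_op.
by rewrite (nth_default _ sj) nth_default ?mulr0 ?subrr// 2?leqW.
Qed.

(** The leading terms cancel, so the difference [D] of the two sides has degree below s. The
    operator is symmetric and does not raise degrees, so [P s] is orthogonal to both [D] and [A D],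
    and [D] is orthogonal to itself. *)
Lemma jacobi_ode s : A (P s) = - (s%:R * (s%:R + nu - 2)) *: P s.
Proof.
set l := s%:R * _; apply/eqP; rewrite -subr_eq0 scaleNr opprK; apply/eqP.
set D := _ + _.
have sD : (size D <= s)%N.
  apply/leq_sizeP => j; rewrite leq_eqVlt coefD coefZ coef_gegenbauer_op.
  move=> /predU1P[<-|sj]; last by rewrite !nth_default ?size_jacobi; [ring|lia..].
  by rewrite (nth_default _ (_ : _ <= s.+2)%N) ?size_jacobi// /l; ring.
apply: (Defs.jacobi_ip_eq0 n_ge3); rewrite {1}/D Defs.jacobi_ipDl// Defs.jacobi_ipZl//.
rewrite gegenbauer_op_sym !jacobi_lower// ?mulr0 ?addr0//.
exact: leq_trans (size_gegenbauer_op _) sD.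
Qed.


(** * Three-term recurrence and values at the end points *)

(* Locked, so that rewriting with linearity lemmas does not unfold it to a
   scaled polynomial. *)
Definition monic_jacobi (s : nat) : {poly R} := locked (((P s)`_s)^-1 *: P s).

Local Notation Q := monic_jacobi.

Lemma lead_jacobi_neq0 s : (P s)`_s != 0.
Proof.
by have := lead_coef_eq0 (P s); rewrite lead_coefE size_jacobi /= => ->; exact: jacobi_neq0.
Qed.

Lemma monic_jacobiE s : Q s = ((P s)`_s)^-1 *: P s.
Proof. by rewrite /monic_jacobi -lock. Qed.

Lemma jacobiE s : P s = (P s)`_s *: Q s.
Proof. by rewrite monic_jacobiE scalerA divff ?lead_jacobi_neq0// scale1r. Qed.

Lemma size_monic_jacobi s : size (Q s) = s.+1.
Proof. by rewrite monic_jacobiE size_scale ?size_jacobi// invr_neq0// lead_jacobi_neq0. Qed.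

Lemma monic_jacobi_lead s : (Q s)`_s = 1.
Proof. by rewrite monic_jacobiE coefZ mulVf// lead_jacobi_neq0. Qed.

Lemma monic_jacobi_neq0 s : Q s != 0.
Proof. by rewrite -size_poly_eq0 size_monic_jacobi. Qed.

Lemma monic_jacobi_lower s (u : {poly R}) : (size u <= s)%N -> ip (Q s) u = 0.
Proof. by move=> us; rewrite monic_jacobiE Defs.jacobi_ipZl// jacobi_lower// mulr0. Qed.

Lemma monic_jacobi_over s i : (s < i)%N -> (Q s)`_i = 0.
Proof. by move=> si; rewrite nth_default// size_monic_jacobi. Qed.

Lemma coef_jacobi_ode s i :
  (i.+1%:R * i.+2%:R) * (P s)`_i.+2 =
  (i%:R * (i%:R + nu - 2) - s%:R * (s%:R + nu - 2)) * (P s)`_i.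
Proof.
have /(congr1 (fun p : {poly R} => p`_i)) := jacobi_ode s.
rewrite coef_gegenbauer_op coefZ => /eqP; rewrite subr_eq => /eqP ->; ring.
Qed.

Lemma coef_monic_jacobi_ode s i :
  (i.+1%:R * i.+2%:R) * (Q s)`_i.+2 =
  (i%:R * (i%:R + nu - 2) - s%:R * (s%:R + nu - 2)) * (Q s)`_i.
Proof. by rewrite monic_jacobiE !coefZ mulrCA coef_jacobi_ode mulrCA. Qed.

(** In the coefficient recursion of degree s + 1 at index s, the coefficient of index s + 2 is 0
    while the factor on the right is not. *)
Lemma monic_jacobi_coef1 s : (Q s.+1)`_s = 0.
Proof.
have := coef_monic_jacobi_ode s.+1 s; rewrite monic_jacobi_over// mulr0 => /esym/eqP.
rewrite mulf_eq0 => /orP[|/eqP//].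
have nu3 := nu_ge3; have s0 : 0 <= s%:R :> R by [].
rewrite (_ : _ - _ = - (2 * s%:R + nu - 1)); last by rewrite -natr1; ring.
by rewrite oppr_eq0 gt_eqF//; lra.
Qed.

Lemma monic_jacobi_coef2 s :
  (Q s.+2)`_s = - (s.+1%:R * s.+2%:R) / (4 * s%:R + 2 * nu).
Proof.
have nu3 := nu_ge3; have s0 : 0 <= s%:R :> R by [].
have := coef_monic_jacobi_ode s.+2 s; rewrite monic_jacobi_lead mulr1 => E.
have d0 : 4 * s%:R + 2 * nu != 0 by rewrite gt_eqF//; lra.
apply: (mulIf d0); rewrite divfK// E; ring.
Qed.

(** It is also the ratio of the squared norms of [Q s.+1] and [Q s], by [monic_jacobi_norm]. *)
Definition rec_coef (s : nat) : R :=
  s.+1%:R * (s%:R + nu - 2) / ((2 * s%:R + nu - 2) * (2 * s%:R + nu)).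

Local Notation beta := rec_coef.

(** The coefficients of degrees s + 2, s + 1 and s agree, so the difference [D] has degree below s.
    It is orthogonal to each of the three terms, since multiplication by 'X can be moved onto
    [D]. *)
Lemma monic_jacobi_rec s : Q s.+2 = 'X * Q s.+1 - beta s *: Q s.
Proof.
have nu3 := nu_ge3; have s0 : 0 <= s%:R :> R by [].
have s2 : (Q s.+2)`_s = ('X * Q s.+1)`_s - beta s.
  (* For s = 0 the product with 'X has no constant term; only from s = 1 on does
     [monic_jacobi_coef2] apply to [Q s.+1]. *)
  rewrite monic_jacobi_coef2 coefXM; case: s s0 => [|s] s0 /=.
    by rewrite /beta; field; rewrite !gt_eqF//=; lra.
  rewrite monic_jacobi_coef2 /beta; move: s0; rewrite -natr1 => s0.
  by field; rewrite !gt_eqF//=; lra.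
apply/eqP; rewrite -subr_eq0; apply/eqP; set D := _ - _.
have sD : (size D <= s)%N.
  apply/leq_sizeP => j sj; rewrite /D coefB coefB coefZ.
  have [->|j1] := eqVneq j s; first by rewrite s2 monic_jacobi_lead; ring.
  rewrite (monic_jacobi_over s) ?ltn_neqAle ?(eq_sym s) ?j1// mulr0 subr0.
  rewrite coefXM gtn_eqF/=; last by lia.
  have [->|j2] := eqVneq j s.+1; first by rewrite !monic_jacobi_coef1 subrr.
  have [->|j3] := eqVneq j s.+2; first by rewrite !monic_jacobi_lead subrr.
  by rewrite !monic_jacobi_over ?subrr//; lia.
apply: (Defs.jacobi_ip_eq0 n_ge3); rewrite {1}/D !Defs.jacobi_ipBl// Defs.jacobi_ipZl//.
rewrite (mulrC 'X) jacobi_ipMC !monic_jacobi_lower ?mulr0 ?subr0//.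
- have [->|D0] := eqVneq D 0; first by rewrite mulr0 size_poly0.
  by rewrite mulrC size_mulX.
- by rewrite (leq_trans sD)// leqW.
Qed.

Lemma monic_jacobi0 : Q 0 = 1.
Proof.
have /eqP/size_poly1P[c c0 E] := size_monic_jacobi 0.
by have := monic_jacobi_lead 0; rewrite E coefC /= => ->.
Qed.

Lemma monic_jacobi1 : Q 1 = 'X.
Proof.
apply/polyP => i; rewrite coefX; case: i => [|[|i]].
- exact: monic_jacobi_coef1.
- exact: monic_jacobi_lead.
- exact: monic_jacobi_over.
Qed.

(** The inner product of [Q s.+1] with ['X * Q s] is computed twice: by leading terms, and by moving
    'X across and using the recurrence. *)
Lemma monic_jacobi_norm s : ip (Q s.+1) (Q s.+1) = beta s * ip (Q s) (Q s).
Proof.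
have -> : ip (Q s.+1) (Q s.+1) = ip (Q s.+1) ('X * Q s).
  have /(monic_jacobi_lower s.+1) : (size ('X * Q s - Q s.+1)%R <= s.+1)%N.
    have := Defs.size_polyB_lead (p := 'X * Q s) (e := Q s.+1) (s := s.+1).
    rewrite monic_jacobi_lead divr1 coefXM /= monic_jacobi_lead scale1r.
    apply; last exact: size_monic_jacobi.
    by rewrite mulrC size_mulX ?size_monic_jacobi// monic_jacobi_neq0.
  rewrite Defs.jacobi_ipC Defs.jacobi_ipBl// => /subr0_eq <-.
  by rewrite Defs.jacobi_ipC.
rewrite -jacobi_ipMC mulrC.
have -> : 'X * Q s.+1 = Q s.+2 + beta s *: Q s by rewrite monic_jacobi_rec subrK.
rewrite Defs.jacobi_ipDl// monic_jacobi_lower ?size_monic_jacobi//.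
by rewrite Defs.jacobi_ipZl// add0r.
Qed.

(** At 1 the three-term recurrence collapses to first order: the induction hypothesis expresses
    [Q s] at 1 through [Q s.+1] at 1. *)
Lemma monic_jacobi_at1 s :
  (2 * s%:R + nu - 2) * (Q s.+1).[1] = (s%:R + nu - 2) * (Q s).[1].
Proof.
have nu3 := nu_ge3; elim: s => [|s IH].
  by rewrite monic_jacobi0 monic_jacobi1 !hornerE; ring.
have s0 : 0 <= s%:R :> R by [].
have d1 : s%:R + nu - 2 != 0 by rewrite gt_eqF//; lra.
have d2 : 2 * s%:R + nu - 2 != 0 by rewrite gt_eqF//; lra.
have d3 : 2 * s%:R + nu != 0 by rewrite gt_eqF//; lra.
have -> : (Q s.+2).[1] = (Q s.+1).[1] - beta s * (Q s).[1].
  by rewrite monic_jacobi_rec hornerD hornerN hornerM hornerX mul1r hornerZ.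
have -> : (Q s).[1] = (2 * s%:R + nu - 2) * (Q s.+1).[1] / (s%:R + nu - 2).
  by rewrite IH mulrAC divff// mul1r.
by rewrite /beta -!natr1; field; rewrite !gt_eqF//=; lra.
Qed.

Lemma monic_jacobi_parity s :
  (Q s).[-1] = (-1) ^+ s * (Q s).[1] /\ (Q s.+1).[-1] = (-1) ^+ s.+1 * (Q s.+1).[1].
Proof.
elim: s => [|s [IH1 IH2]].
  by rewrite monic_jacobi0 monic_jacobi1 !hornerE.
split=> //; rewrite monic_jacobi_rec !hornerD !hornerN !hornerM !hornerX !hornerZ.
by rewrite IH1 IH2 !exprS; ring.
Qed.

Lemma jacobi_at_opp1 s : (P s).[-1] ^+ 2 = (P s).[1] ^+ 2.
Proof.
rewrite jacobiE !hornerZ; have [-> _] := monic_jacobi_parity s.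
by rewrite !exprMn -exprM mulnC exprM sqrrN expr1n expr1n mul1r.
Qed.

(** * The maximum of the Jacobi polynomials *)

Lemma poly_ndecr (p : {poly R}) (a b : R) : a <= b ->
  (forall x : R, a < x < b -> 0 <= p^`().[x]) -> p.[a] <= p.[b].
Proof.
move=> ab p0; apply: (@ger0_derive1_ndecr _ (horner p) a b) => //.
- by move=> x; rewrite in_itv/= => xab; rewrite -derivE; exact: p0.
- by apply: continuous_subspaceT; exact: continuous_horner.
Qed.

Lemma jacobi0 : P 0 = 1.
Proof.
have /eqP/size_poly1P[c c0 E] := size_jacobi 0.
have [_ _ /(_ 0%N)] := jacobiP R n_ge3.
by rewrite E hornerC /gbinom big_ord0 fact0 divr1 => ->.
Qed.

(* Sonine's argument: by the differential equation, the derivative of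
   l P^2 + (1 - t^2) P'^2 with l = s (s + n - 2) is 2 (n - 2) t P'^2, so this
   function is largest at the end points. *)
Lemma jacobi_le1 s (t : R) : -1 <= t <= 1 -> (P s).[t] <= (P s).[1].
Proof.
(* For s = 0 the factor l would be 0 and could not be cancelled at the end. *)
have nu3 := nu_ge3; case: s => [|s] t1; first by rewrite jacobi0 !hornerE.
set l := s.+1%:R * (s.+1%:R + nu - 2).
have s0 : 0 < s.+1%:R :> R by [].
have l0 : 0 < l by rewrite mulr_gt0//; lra.
pose p := P s.+1; pose S := l *: p ^+ 2 + (1 - 'X ^+ 2) * p^`() ^+ 2.
have dS : S^`() = (2 * (nu - 2)) *: ('X * p^`() ^+ 2).
  have n1 : (n - 1)%:R = nu - 1 by rewrite natrB// ltnW// ltnW.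
  have := jacobi_ode s.+1; rewrite -/p -/l /gegenbauer_op n1 scaleNr.
  rewrite /S derivD derivZ !expr2 !derivM derivB derivM derivX derivC -!mul_polyC.
  have -> : (2 * (nu - 2))%:P = 2 * ((nu - 1)%:P - 1) :> {poly R}.
    by rewrite -polyC1 -polyCB polyCM rmorph_nat; congr (_ * _%:P); ring.
  move: (l%:P) (p^`()) (p^`()^`()) ((nu - 1)%:P) => L a b c E.
  have {}E : (1 - 'X * 'X) * b = c * ('X * a) - L * p.
    by move/eqP: E; rewrite subr_eq => /eqP ->; ring.
  transitivity (2 * a * (L * p - 'X * a + (1 - 'X * 'X) * b)).
    by ring.
  by rewrite E; ring.
have SE x : S.[x] = l * p.[x] ^+ 2 + (1 - x ^+ 2) * p^`().[x] ^+ 2.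
  by rewrite /S !hornerE.
have dSE x : S^`().[x] = (2 * (nu - 2)) * (x * p^`().[x] ^+ 2).
  by rewrite dS hornerZ hornerM hornerX horner_exp.
have S1 : S.[1] = l * p.[1] ^+ 2 by rewrite SE; ring.
have SN1 : S.[-1] = l * p.[1] ^+ 2.
  by rewrite -jacobi_at_opp1 -/p SE; ring.
have St : S.[t] <= l * p.[1] ^+ 2.
  have [t0|t0] := leP 0 t.
    rewrite -S1; apply: poly_ndecr => [|x xt]; first by case/andP: t1.
    rewrite dSE mulr_ge0//; first by lra.
    by rewrite mulr_ge0 ?sqr_ge0//; lra.
  rewrite -SN1 -lerN2 -!hornerN; apply: poly_ndecr => [|x xt].
    by case/andP: t1.
  rewrite derivN hornerN dSE oppr_ge0 mulr_ge0_le0//; first by lra.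
  by rewrite mulr_le0_ge0 ?sqr_ge0//; lra.
have : l * p.[t] ^+ 2 <= S.[t].
  by rewrite SE lerDl mulr_ge0 ?sqr_ge0//; nra.
move=> /le_trans/(_ St); rewrite ler_pM2l// => pt.
have p1 : 0 < p.[1] by exact: jacobi1_gt0.
by rewrite leNgt; apply/negP => ltp; nra.
Qed.

(** * The values of the reproducing kernel at 1 *)

(* The dimension of the space of spherical harmonics of degree s on the unit
   sphere of R^n. *)
Definition jacobi_dim s : R := ip 1 1 * (P s).[1] ^+ 2 / ip (P s) (P s).

Lemma jacobi_ip11_gt0 : 0 < ip 1 1.
Proof. by apply: jacobi_ip_gt0; exact: oner_neq0. Qed.

Lemma jacobi_dim_gt0 s : 0 < jacobi_dim s.
Proof.
rewrite divr_gt0 ?mulr_gt0 ?exprn_gt0 ?jacobi1_gt0 ?jacobi_ip11_gt0//.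
exact/jacobi_ip_gt0/jacobi_neq0.
Qed.

Lemma jacobi_dim0 : jacobi_dim 0 = 1.
Proof.
by rewrite /jacobi_dim jacobi0 hornerC expr1n mulr1 divff// gt_eqF// jacobi_ip11_gt0.
Qed.

(** The quotient is invariant under rescaling of [P s], so the recursions for the monic polynomials
    apply to it. *)
Lemma jacobi_dim_monicE s :
  jacobi_dim s = ip 1 1 * (Q s).[1] ^+ 2 / ip (Q s) (Q s).
Proof.
have q0 : ip (Q s) (Q s) != 0 by rewrite gt_eqF// jacobi_ip_gt0// monic_jacobi_neq0.
have l0 := lead_jacobi_neq0 s.
rewrite /jacobi_dim jacobiE hornerZ Defs.jacobi_ipZl// Defs.jacobi_ipZr//.
by field; rewrite q0 l0.
Qed.

Lemma jacobi_dim_rec s : s.+1%:R * (2 * s%:R + nu - 2) * jacobi_dim s.+1 =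
  (s%:R + nu - 2) * (2 * s%:R + nu) * jacobi_dim s.
Proof.
have nu3 := nu_ge3; have s0 : 0 <= s%:R :> R by [].
have s1 : 0 < s.+1%:R :> R by [].
have d2 : 2 * s%:R + nu - 2 != 0 by rewrite gt_eqF//; lra.
have q0 : 0 < ip (Q s) (Q s) by rewrite jacobi_ip_gt0// monic_jacobi_neq0.
have q1 : (Q s.+1).[1] = (s%:R + nu - 2) * (Q s).[1] / (2 * s%:R + nu - 2).
  by rewrite -monic_jacobi_at1 mulrAC divff// mul1r.
rewrite !jacobi_dim_monicE monic_jacobi_norm q1 /beta.
by field; rewrite !gt_eqF//=; lra.
Qed.

(* Hypergeometric telescoping: the partial sums are a rational multiple of
   the last term. *)
Lemma sum_jacobi_dim_last d :
  (nu - 1) * (2 * d%:R + nu - 2) * (\sum_(s < d.+1) jacobi_dim s) =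
  (d%:R + nu - 2) * (2 * d%:R + nu - 1) * jacobi_dim d.
Proof.
have nu3 := nu_ge3; elim: d => [|d IH].
  by rewrite big_ord_recr big_ord0 /=; ring.
have s0 : 0 <= d%:R :> R by [].
have d2 : 2 * d%:R + nu - 2 != 0 by rewrite gt_eqF//; lra.
have d3 : d%:R + nu - 2 != 0 by rewrite gt_eqF//; lra.
have d4 : 2 * d%:R + nu != 0 by rewrite gt_eqF//; lra.
rewrite big_ord_recr /=; move: IH (jacobi_dim_rec d); rewrite -!(natr1 d).
move: (\sum_(_ < _) _) (jacobi_dim d) (jacobi_dim d.+1) => S D D' IH rec.
have DE : D = (d%:R + 1) * (2 * d%:R + nu - 2) * D' / ((d%:R + nu - 2) * (2 * d%:R + nu)).
  by rewrite rec; field; rewrite d3 d4.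
apply: (mulfI d2).
have -> : (2 * d%:R + nu - 2) * ((nu - 1) * (2 * (d%:R + 1) + nu - 2) * (S + D')) =
  (2 * (d%:R + 1) + nu - 2) * ((nu - 1) * (2 * d%:R + nu - 2) * S +
    (nu - 1) * (2 * d%:R + nu - 2) * D') by ring.
by rewrite IH DE; field; rewrite d3 d4.
Qed.

(** The last term is a multiple of the partial sum by [sum_jacobi_dim_last], hence so is the next
    term by [jacobi_dim_rec]. *)
Lemma sum_jacobi_dim_rec d :
  d.+1%:R * (2 * d%:R + nu - 1) * (\sum_(s < d.+2) jacobi_dim s) =
  (d%:R + nu - 1) * (2 * d%:R + nu + 1) * \sum_(s < d.+1) jacobi_dim s.
Proof.
have nu3 := nu_ge3.
have s0 : 0 <= d%:R :> R by [].
have d2 : 2 * d%:R + nu - 2 != 0 by rewrite gt_eqF//; lra.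
have d3 : d%:R + nu - 2 != 0 by rewrite gt_eqF//; lra.
have d4 : 2 * d%:R + nu != 0 by rewrite gt_eqF//; lra.
have d5 : 2 * d%:R + nu - 1 != 0 by rewrite gt_eqF//; lra.
have d6 : d%:R + 1 != 0 :> R by rewrite gt_eqF//; lra.
rewrite big_ord_recr /=; move: (sum_jacobi_dim_last d) (jacobi_dim_rec d).
rewrite -!(natr1 d).
move: (\sum_(_ < _) _) (jacobi_dim d) (jacobi_dim d.+1) => S D D' IH rec.
have DE : D = (nu - 1) * (2 * d%:R + nu - 2) * S / ((d%:R + nu - 2) * (2 * d%:R + nu - 1)).
  by rewrite IH; field; rewrite d3 d5.
have -> : D' = (d%:R + nu - 2) * (2 * d%:R + nu) * D / ((d%:R + 1) * (2 * d%:R + nu - 2)).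
  by rewrite -rec; field; rewrite d6 d2.
by rewrite DE; field; rewrite d2 d3 d5 d6.
Qed.

(** The sum is the dimension C(d + n - 1, n - 1) + C(d + n - 2, n - 1) of the polynomials of degree
    at most d on the sphere. Both sides obey the recursion of [sum_jacobi_dim_rec]. *)
Lemma sum_jacobi_dim d : (nu - 1) * \sum_(s < d.+1) jacobi_dim s =
  'C(d + (n - 2), n - 2)%:R * (2 * d%:R + nu - 1).
Proof.
have nu3 := nu_ge3; elim: d => [|d IH].
  by rewrite big_ord_recr big_ord0 /= jacobi_dim0 add0n binn; ring.
have s0 : 0 <= d%:R :> R by [].
have d5 : d.+1%:R * (2 * d%:R + nu - 1) != 0.
  by rewrite mulf_neq0 ?pnatr_eq0// gt_eqF//; lra.
apply: (mulfI d5); rewrite mulrCA sum_jacobi_dim_rec mulrCA IH.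
have E : d.+1%:R * 'C(d.+1 + (n - 2), n - 2)%:R =
    (d%:R + nu - 1) * 'C(d + (n - 2), n - 2)%:R :> R.
  have := mul_bin_down (d.+1 + (n - 2)) (n - 2).
  rewrite addnK addSn /= => /(congr1 (GRing.natmul (1 : R))).
  rewrite !natrM => <-; congr (_ * _).
  by rewrite -addSn natrD natrB ?(ltnW n_ge3)// -natr1; ring.
set B' : R := 'C(d.+1 + _, _)%:R in E *; set B : R := 'C(d + _, _)%:R in E *.
rewrite -!(natr1 d) in E *.
transitivity (((d%:R + 1) * B') * ((2 * d%:R + nu - 1) * (2 * d%:R + nu + 1))).
  by rewrite E; ring.
by ring.
Qed.

(** * Growth of the partial sums *)

Lemma bin_lower_bound (d m : nat) : (d.+1 ^ m <= m`! * 'C(d + m, m))%N.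
Proof.
rewrite mulnC bin_ffact ffact_prod -[X in (_ ^ X)%N](card_ord m) -prod_nat_const.
by apply: leq_prod => i _; have := ltn_ord i; lia.
Qed.

Lemma bin_upper_bound (d m : nat) : ('C(d + m, m) <= (d + m) ^ m)%N.
Proof.
apply: (@leq_trans ((d + m) ^_ m)).
  by rewrite -bin_ffact leq_pmulr// fact_gt0.
rewrite ffact_prod -[X in (_ ^ X)%N](card_ord m) -prod_nat_const.
by apply: leq_prod => i _; exact: leq_subr.
Qed.

Let n1E : (n - 1 = (n - 2).+1)%N. Proof. by move: n_ge3; lia. Qed.

Lemma sum_jacobi_dim_ge d :
  (d.+1%:R ^+ (n - 1)) / (n - 1)`!%:R <= \sum_(s < d.+1) jacobi_dim s.
Proof.
have nu3 := nu_ge3; set S := \sum_(_ < _) _.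
have E := sum_jacobi_dim d; rewrite -/S in E.
have fle : d.+1%:R ^+ (n - 2) <= (n - 2)`!%:R * 'C(d + (n - 2), n - 2)%:R :> R.
  by rewrite -natrX -natrM ler_nat bin_lower_bound.
rewrite ler_pdivrMr ?ltr0n ?fact_gt0// n1E factS exprSr.
have n1 : (n - 2).+1%:R = nu - 1 by rewrite -n1E natrB// ltnW// ltnW.
rewrite natrM n1 mulrA [S * _]mulrC E mulrAC [X in _ <= X * _]mulrC.
have d0 : 0 <= d%:R :> R by [].
by apply: ler_pM => //; rewrite -(natr1 d); lra.
Qed.

Lemma sum_jacobi_dim_le k : (0 < k)%N ->
  \sum_(s < k) jacobi_dim s <= (nu ^+ (n - 1)) * k%:R ^+ (n - 1).
Proof.
case: k => // d _.
have nu3 := nu_ge3; set S := \sum_(_ < _) _.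
have E := sum_jacobi_dim d; rewrite -/S in E.
have fle : 'C(d + (n - 2), n - 2)%:R <= (n * d.+1)%:R ^+ (n - 2) :> R.
  rewrite -natrX ler_nat (leq_trans (bin_upper_bound _ _))// leq_exp2r; last by lia.
  by nia.
rewrite -exprMn -natrM n1E exprSr.
have d0 : 0 <= d%:R :> R by [].
(* The factor n - 1 >= 1 is given away; the binomial coefficient and the linear factor are then
   bounded by powers of n (d + 1). *)
have : S <= (nu - 1) * S.
  rewrite ler_peMl ?sumr_ge0//; last by lra.
  by move=> i _; exact/ltW/jacobi_dim_gt0.
move=> /le_trans; apply; rewrite E ler_pM//; first by lra.
by rewrite natrM -(natr1 d); nra.
Qed.

(** * The linear program *)

Local Notation S d := (\sum_(s < d.+1) jacobi_dim s).

Definition jacobi_kernel d : {poly R} :=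
  \sum_(s < d.+1) ((P s).[1] / ip (P s) (P s)) *: P s.

Local Notation K := jacobi_kernel.

Lemma jacobi_ip_suml I (r : seq I) (F : I -> {poly R}) q :
  ip (\sum_(i <- r) F i) q = \sum_(i <- r) ip (F i) q.
Proof.
elim: r => [|x r IH]; last by rewrite !big_cons Defs.jacobi_ipDl// IH.
by rewrite !big_nil -(scale0r 0) Defs.jacobi_ipZl// mul0r.
Qed.

Lemma jacobi_kernel1 d : ip 1 1 * (K d).[1] = S d.
Proof.
rewrite /K horner_sum mulr_sumr; apply: eq_bigr => s _.
by rewrite hornerZ /jacobi_dim expr2 mulrA; ring.
Qed.

Lemma jacobi_ip_kernel d r :
  ip (P r) (K d) = if (r <= d)%N then (P r).[1] else 0.
Proof.
rewrite Defs.jacobi_ipC /K jacobi_ip_suml.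
have [rd|rd] := leqP r d.
  rewrite (bigD1 (Ordinal (rd : (r < d.+1)%N)))//= big1 => [|s sr].
    rewrite addr0 Defs.jacobi_ipZl// divfK// gt_eqF//.
    exact/jacobi_ip_gt0/jacobi_neq0.
  by rewrite Defs.jacobi_ipZl// (jacobi_orthogonal _ _ sr) mulr0.
rewrite big1// => s _; have sr : (s : nat) != r by rewrite ltn_eqF// (leq_trans _ rd).
by rewrite Defs.jacobi_ipZl// (jacobi_orthogonal _ _ sr) mulr0.
Qed.

Lemma jacobi_expansion d (f : {poly R}) : (size f <= d)%N ->
  exists a : nat -> R, f = \sum_(s < d) a s *: P s.
Proof.
elim: d f => [|d IH] f sf.
  exists (fun=> 0); rewrite big_ord0; apply/eqP.
  by rewrite -size_poly_eq0 -leqn0.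
have [a E] := IH _ (Defs.size_polyB_lead sf (size_jacobi d)).
exists (fun s => if s == d then f`_d / (P d)`_d else a s).
rewrite big_ord_recr /= eqxx -[LHS](subrK ((f`_d / (P d)`_d) *: P d)) E.
by congr (_ + _); apply: eq_bigr => s _; rewrite ltn_eqF.
Qed.

Lemma jacobi_kernel_repr d (f : {poly R}) : (size f <= d.+1)%N ->
  ip f (K d) = f.[1].
Proof.
move=> /jacobi_expansion[a ->]; rewrite jacobi_ip_suml horner_sum.
apply: eq_bigr => s _; rewrite Defs.jacobi_ipZl// hornerZ jacobi_ip_kernel.
by rewrite -ltnS ltn_ord.
Qed.

Lemma jacobi_ip_series m (a : nat -> R) :
  ip (\sum_(s < m.+1) a s *: P s) 1 = a 0%N * ip 1 1.
Proof.
rewrite jacobi_ip_suml big_ord_recl /= jacobi0 Defs.jacobi_ipZl// big1 ?addr0// => s _.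
by rewrite Defs.jacobi_ipZl// jacobi_lower ?mulr0// size_poly1.
Qed.

Lemma jacobi_kernel_le d (t : R) : -1 <= t <= 1 -> (K d).[t] <= (K d).[1].
Proof.
move=> t1; rewrite !horner_sum; apply: ler_sum => s _.
rewrite !hornerZ ler_wpM2l ?jacobi_le1// ltW// divr_gt0 ?jacobi1_gt0//.
exact/jacobi_ip_gt0/jacobi_neq0.
Qed.

Lemma lp_feasible_le k m a : lp_feasible n k.+1 m a -> 1 / a 0%N <= S k.
Proof.
move=> [F0 F1 ak]; set F : {poly R} := \sum_(_ < _) _ in F0 F1.
(* Pairing with the kernel evaluates the terms with s <= k at 1 and drops the others, whose values
   at 1 are at most 0. *)
have le1 : 1 <= ip F (K k).
  rewrite -F1 /F horner_sum jacobi_ip_suml; apply: ler_sum => s _.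
  rewrite hornerZ Defs.jacobi_ipZl// jacobi_ip_kernel.
  have [//|ks] := leqP s k; rewrite mulr0 mulr_le0_ge0//.
    by apply: ak; rewrite ks -ltnS ltn_ord.
  exact/ltW/jacobi1_gt0.
have le2 : ip F (K k) <= (K k).[1] * ip F 1.
  rewrite -subr_ge0 -Defs.jacobi_ipZr// Defs.jacobi_ipC (Defs.jacobi_ipC _ F (K k)).
  rewrite -Defs.jacobi_ipBl// Defs.jacobi_ipC -[X in ip F X]mulr1 -jacobi_ipMC.
  apply: jacobi_ip_ge0 => t t1; rewrite hornerM hornerD hornerN hornerZ hornerC.
  by rewrite mulr1 mulr_ge0 ?F0// subr_ge0 jacobi_kernel_le.
have a0S : 1 <= S k * a 0%N.
  rewrite -jacobi_kernel1 (le_trans le1)// (le_trans le2)//.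
  by rewrite /F jacobi_ip_series; rewrite le_eqVlt; apply/orP; left; apply/eqP; ring.
have S0 : 0 <= S k by apply: sumr_ge0 => s _; exact/ltW/jacobi_dim_gt0.
(* Positivity, needed for the division, follows from 1 <= S a_0 and S >= 0. *)
have a0 : 0 < a 0%N by rewrite ltNge; apply/negP => a0; nra.
by rewrite ler_pdivrMr.
Qed.

(* The witness is (K_d / K_d(1))^2. *)
Lemma lp_feasible_kernel k d : (d.*2 <= k)%N ->
  exists a : nat -> R, lp_feasible n k.+1 k a /\ 1 / a 0%N = S d.
Proof.
move=> dk; pose q := (K d).[1]^-1 *: K d.
have S0 : 0 < S d.
  rewrite big_ord_recl ltr_pwDl ?jacobi_dim_gt0// sumr_ge0// => s _.
  exact/ltW/jacobi_dim_gt0.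
have W0 := jacobi_ip11_gt0.
have K0 : 0 < (K d).[1] by rewrite -(pmulr_rgt0 _ W0) jacobi_kernel1.
have sK : (size (K d) <= d.+1)%N.
  apply: (leq_trans (size_sum _ _ _)); apply/bigmax_leqP => s _.
  by rewrite (leq_trans (size_scale_leq _ _))// size_jacobi ltn_ord.
have sq : (size q <= d.+1)%N by exact: leq_trans (size_scale_leq _ _) sK.
have [a E] : exists a : nat -> R, q ^+ 2 = \sum_(s < k.+1) a s *: P s.
  apply: jacobi_expansion; rewrite expr2 (leq_trans (size_polyMleq _ _))//.
  by move: (size q) sq => z zd; lia.
have q1 : q.[1] = 1 by rewrite hornerZ mulVf// gt_eqF.
(* One factor of the square is a multiple of the kernel, which reproduces the value 1 of the other
   factor at 1. *)
have a0 : a 0%N * ip 1 1 = (K d).[1]^-1.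
  rewrite -(jacobi_ip_series k) -E expr2 jacobi_ipMC mulr1 {2}/q Defs.jacobi_ipZr//.
  by rewrite jacobi_kernel_repr// q1 mulr1.
exists a; split; last first.
  rewrite -jacobi_kernel1.
  have -> : a 0%N = (K d).[1]^-1 / ip 1 1 by rewrite -a0 mulfK// gt_eqF.
  by field; rewrite !gt_eqF.
split; rewrite -?E.
- by move=> t _; rewrite horner_exp sqr_ge0.
- by rewrite horner_exp q1 expr1n.
(* The sign condition is vacuous: the expansion stops at index k and the constraint starts at k +
   1. *)
- by move=> s; rewrite ltnNge andNb.
Qed.

Lemma NLP_le k : (0 < k)%N -> (NLP R n k <= (\sum_(s < k) jacobi_dim s)%:E)%E.
Proof.
case: k => // k _; apply: ge_ereal_sup => _ [m [a [Fa ->]]].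
by rewrite lee_fin; exact: lp_feasible_le Fa.
Qed.

Lemma NLP_ge k d : (d.*2 < k)%N -> ((S d)%:E <= NLP R n k)%E.
Proof.
case: k => // k dk; have [a [Fa <-]] := lp_feasible_kernel k d dk.
by apply: ereal_sup_ubound; exists k, a.
Qed.
End Jacobi.

(** * Asymptotics of the bound *)

Theorem mainTheorem5 (R : realType) (n : nat) (n_ge6 : (6 <= n)%N) :
  exists c C : R, [/\ 0 < c, c <= C &
    \forall k \near \oo,
      ((c * k%:R ^+ (n - 1))%:E <= NLP R n k)%E /\
      (NLP R n k <= (C * k%:R ^+ (n - 1))%:E)%E].
Proof.
have n_ge3 : (3 <= n)%N by exact: leq_trans n_ge6.
pose c : R := (2 ^+ (n - 1) * (n - 1)`!%:R)^-1.
exists c, (n%:R ^+ (n - 1)); split.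
- by rewrite invr_gt0 mulr_gt0 ?exprn_gt0// ltr0n fact_gt0.
- apply: (@le_trans _ _ 1).
    rewrite invf_le1 ?mulr_gt0 ?exprn_gt0 ?ltr0n ?fact_gt0//.
    by rewrite -natrX -natrM ler1n muln_gt0 expn_gt0 fact_gt0.
  by rewrite exprn_ege1// ler1n ltnW// ltnW.
exists 1%N => // k /= k0; split; last first.
  apply: (le_trans (NLP_le R n n_ge3 k k0)); rewrite lee_fin.
  exact: sum_jacobi_dim_le.
(* The largest admissible d is the half of k - 1 rounded down. It satisfies d + 1 >= k / 2, whence
   the power of 2 in [c]. *)
have dk : ((k.-1)./2.*2 < k)%N by lia.
apply: le_trans (NLP_ge R n n_ge3 k _ dk); rewrite lee_fin.
apply: le_trans (sum_jacobi_dim_ge R n n_ge3 _).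
rewrite /c invfM mulrAC ler_wpM2r ?invr_ge0// mulrC -exprVn -exprMn.
rewrite lerXn2r ?nnegrE ?mulr_ge0 ?invr_ge0//.
rewrite ler_pdivrMr// -natrM ler_nat; lia.
Qed.
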